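(* Let $\Lambda$ be a quantum operation and $\Gamma$ the einselection operation on a Hilbert space $\mathcal{H}$. The following are equivalent: (1) $\Lambda\circ\Gamma=\Gamma\circ\Lambda$; (2) $W(\Lambda)=0$, where $W(\Lambda)=\sup_\rho S\big(\Lambda\circ\Gamma(\rho)\,\|\,\Gamma\circ\Lambda(\rho)\big)$; (3) for all states $\rho$, both the distinguishing power $S\big(\Gamma\circ\Lambda\circ\Gamma(\rho)\,\|\,\Gamma\circ\Lambda(\rho)\big)$ and the generating power $S\big(\Lambda\circ\Gamma(\rho)\,\|\,\Gamma\circ\Lambda\circ\Gamma(\rho)\big)$ vanish.
   Context: $\mathcal{H}$ is a finite-dimensional Hilbert space; states are density operators on it, and suprema are over all states. A quantum operation $\Lambda:\mathcal{B}(\mathcal{H})\to\mathcal{B}(\mathcal{H})$ is a completely positive trace-preserving linear map. The relative entropy is $S(\rho\|\sigma)=\mathrm{Tr}[\rho(\log_2\rho-\log_2\sigma)]$, equal to $+\infty$ if the support of $\rho$ is not contained in the support of $\sigma$. The einselection operation is $\Gamma(\rho)=\sum_\alpha\Pi_\alpha\rho\Pi_\alpha$ with $\Pi_\alpha$ mutually orthogonal projectors, $\sum_\alpha\Pi_\alpha=\mathbf{1}$; here $\Pi_\alpha=|\alpha\rangle\langle\alpha|$ for a fixed orthonormal basis of pointer states or, when $\mathcal{H}$ is bipartite, $\Gamma=\Gamma_1\otimes\Gamma_2$ with each $\Gamma_k$ such a dephasing in a local orthonormal basis, one of the $\Gamma_k$ possibly replaced by the identity map. Classical states are those with $\Gamma(\rho)=\rho$.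 *)

(* Defs.v *)
From HB Require Import structures.
From mathcomp Require Import all_boot all_order all_algebra.
From mathcomp Require Import sesquilinear spectral complex mxtens.
From mathcomp Require Import all_classical all_reals all_analysis.

Set Implicit Arguments.
Unset Strict Implicit.
Unset Printing Implicit Defensive.

Import Order.TTheory GRing.Theory Num.Theory.

Local Open Scope ring_scope.
Local Open Scope sesquilinear_scope.

(* The Hilbert space of dimension n is the space 'rV[R[i]]_n of row vectors,
   with inner product <u, v> = u *m v ^t*, and an operator A : 'M[R[i]]_n acts
   on it by u |-> u *m A.  This is the convention of kermx, unitarymx and
   spectralmx.  The tensor product of the spaces of dimensions m and n is the
   space of dimension m * n, through the Kronecker product *t. *)

Section States.
Context {R : realType}.
Local Notation C := R[i].

(* In the order of R[i], 0 <= z means that z is real and nonnegative, so that a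
   matrix satisfying psdmx is Hermitian. *)
Definition psdmx n (A : 'M[C]_n) : Prop :=
  forall v : 'rV[C]_n, 0 <= (v *m A *m v ^t*) 0 0.

Definition states n : set 'M[C]_n := [set rho | psdmx rho /\ \tr rho = 1]%classic.

(* The orthogonal complement of the kernel. *)
Definition mxsupport n (A : 'M[C]_n) : 'M[C]_n := orthomx Num.conj 1%:M (kermx A).

Definition log2 (x : R) : R := ln x / ln 2.

(* Functional calculus on a diagonalization of A in an orthonormal basis.  As
   ln 0 = 0, logmx A vanishes on the kernel of A. *)
Definition logmx n (A : 'M[C]_n) : 'M[C]_n :=
  (spectralmx A) ^t* *m
  diag_mx (map_mx (fun z => (log2 (complex.Re z))%:C%C) (spectral_diag A)) *m
  spectralmx A.

Definition relative_entropy n (rho sigma : 'M[C]_n) : \bar R :=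
  if (mxsupport rho <= mxsupport sigma)%MS
  then (complex.Re (\tr (rho *m (logmx rho - logmx sigma))))%:E
  else +oo%E.

End States.

Arguments states {R} n.

Section Operations.
Context {R : realType}.
Local Notation C := R[i].

(* For linear F and G, the linear map F (x) G, given by its values on the
   products of matrix units. *)
Definition tensmap m n (F : 'M[C]_m -> 'M[C]_m) (G : 'M[C]_n -> 'M[C]_n)
    (X : 'M[C]_(m * n)) : 'M[C]_(m * n) :=
  \sum_(i < m) \sum_(j < m) \sum_(k < n) \sum_(l < n)
    X (mxtens_index (i, k)) (mxtens_index (j, l)) *:
      (F (delta_mx i j) *t G (delta_mx k l)).

Lemma tensmapE m n (F : {linear 'M[C]_m -> 'M[C]_m})
    (G : {linear 'M[C]_n -> 'M[C]_n}) (A : 'M[C]_m) (B : 'M[C]_n) :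
  tensmap F G (A *t B) = F A *t G B.
Proof.
apply/matrixP => a b; case: (mxtens_indexP a) => a1 a2.
case: (mxtens_indexP b) => b1 b2; rewrite tensmxE.
rewrite [X in F X]matrix_sum_delta [X in G X]matrix_sum_delta.
rewrite !linear_sum /tensmap !summxE big_distrl /=; apply: eq_bigr => i _.
rewrite linear_sum !summxE big_distrl /=; apply: eq_bigr => j _.
rewrite summxE big_distrr /=; apply: eq_bigr => k _.
rewrite linear_sum !summxE big_distrr /=; apply: eq_bigr => l _.
by rewrite !linearZ !mxE !mxtens_indexK /= mulrACA.
Qed.

Definition completely_positive n (Lambda : 'M[C]_n -> 'M[C]_n) : Prop :=
  forall (k : nat) (A : 'M[C]_(n * k)), psdmx A -> psdmx (tensmap Lambda id A).

Definition trace_preserving n (Lambda : 'M[C]_n -> 'M[C]_n) : Prop :=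
  forall A : 'M[C]_n, \tr (Lambda A) = \tr A.

Definition quantum_operation n (Lambda : {linear 'M[C]_n -> 'M[C]_n}) : Prop :=
  completely_positive Lambda /\ trace_preserving Lambda.

Definition pinching (I : finType) n (P : I -> 'M[C]_n) (X : 'M[C]_n) : 'M[C]_n :=
  \sum_(a : I) P a *m X *m P a.

(* The pointer states are the rows of U, an orthonormal basis when U is
   unitary; (row a U) ^t* *m row a U is the projector |a><a|, which acts by
   u |-> <u, a> a. *)
Definition dephasing n (U : 'M[C]_n) : 'M[C]_n -> 'M[C]_n :=
  pinching (fun a : 'I_n => (row a U) ^t* *m row a U).

Inductive einselection : forall n, ('M[C]_n -> 'M[C]_n) -> Prop :=
| einselection_basis n (U : 'M[C]_n) :
    U \is unitarymx -> einselection (dephasing U)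
| einselection_local m n (U : 'M[C]_m) (V : 'M[C]_n) :
    U \is unitarymx -> V \is unitarymx ->
    einselection (tensmap (dephasing U) (dephasing V))
| einselection_left m n (U : 'M[C]_m) :
    U \is unitarymx -> einselection (tensmap (dephasing U) (@id 'M[C]_n))
| einselection_right m n (V : 'M[C]_n) :
    V \is unitarymx -> einselection (tensmap (@id 'M[C]_m) (dephasing V)).

Section Powers.
Variables (n : nat) (Lambda Gamma : 'M[C]_n -> 'M[C]_n).

Definition W : \bar R :=
  ereal_sup [set relative_entropy (Lambda (Gamma rho)) (Gamma (Lambda rho))
            | rho in states n]%classic.

Definition distinguishing_power (rho : 'M[C]_n) : \bar R :=
  relative_entropy (Gamma (Lambda (Gamma rho))) (Gamma (Lambda rho)).

Definition generating_power (rho : 'M[C]_n) : \bar R :=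
  relative_entropy (Lambda (Gamma rho)) (Gamma (Lambda (Gamma rho))).

End Powers.

End Operations.

(* Main.v *)
(* If rho and sigma have eigenbases u_i and v_j with eigenvalues p_i and q_j,
   the relative entropy of rho and sigma is the sum over i and j of
   |<u_i, v_j>|^2 p_i (log p_i - log q_j).  By Klein's inequality it is
   nonnegative on states, and it vanishes only if p_i = q_j whenever u_i and v_j
   are not orthogonal, that is, only if rho = sigma.  So each of (2) and (3)
   says that certain linear maps agree on all states, hence everywhere by
   polarization; (1) implies (3) because the einselection, being the pinching by
   a projective measurement also in the bipartite cases, is idempotent. *)

Require Import Defs.
From HB Require Import structures.
From mathcomp Require Import all_boot all_order all_algebra.
From mathcomp Require Import sesquilinear spectral complex mxtens ring lra.
From mathcomp Require Import all_classical all_reals all_analysis.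

Set Implicit Arguments.
Unset Strict Implicit.
Unset Printing Implicit Defensive.

Import Order.TTheory GRing.Theory Num.Theory.

Local Open Scope ring_scope.
Local Open Scope sesquilinear_scope.

(** * Polarization: linear maps on matrices are determined by rank-one Hermitian matrices *)

Section Polarization.
Variables (C : numClosedFieldType) (n : nat) (V : lmodType C).
Variable D : {linear 'M[C]_n -> V}.

Lemma trmxC_mul m p q (A : 'M[C]_(m, p)) (B : 'M[C]_(p, q)) :
  (A *m B)^t* = B^t* *m A^t*.
Proof. by rewrite trmx_mul map_mxM. Qed.

(** Expanding [D] at [u + v] shows that the cross terms are antisymmetric in [u] and [v]. Replacing
    [v] by ['i *: v] makes them symmetric as well, because conjugation changes the sign of ['i].
    Hence they vanish, and the matrix units are among them. *)
Lemma linear_rank1_eq0 :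
  (forall v : 'rV[C]_n, D (v^t* *m v) = 0) -> D =1 fun=> 0.
Proof.
move=> D0.
have antisym (u v : 'rV[C]_n) : D (u^t* *m v) = - D (v^t* *m u).
  apply/eqP; rewrite -addr_eq0; apply/eqP; move: (D0 (u + v)).
  have -> : (u + v)^t* = u^t* + v^t* by rewrite linearD map_mxD.
  by rewrite mulmxDl !mulmxDr !linearD /= !D0 add0r addr0.
have polar (u v : 'rV[C]_n) : D (u^t* *m v) = 0.
  have := antisym u ('i *: v).
  have -> : ('i *: v)^t* = - 'i *: v^t*.
    by rewrite linearZ map_mxZ /= conjCi.
  rewrite -scalemxAr -scalemxAl !linearZ /= scaleNr scalerN opprK => /eqP.
  rewrite (inj_eq (scalerI (neq0Ci C))) => /eqP sym.
  apply/eqP; have /eqP := antisym u v; rewrite -sym -addr_eq0 -mulr2n.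
  by rewrite -scaler_nat scaler_eq0 pnatr_eq0.
move=> A; rewrite [A]matrix_sum_delta linear_sum big1 // => i _.
rewrite linear_sum big1 // => j _; rewrite linearZ /=.
have -> : delta_mx i j = (delta_mx 0 i : 'rV[C]_n)^t* *m delta_mx 0 j.
  by rewrite trmx_delta map_delta_mx mul_delta_mx.
by rewrite polar scaler0.
Qed.

End Polarization.

(** * Klein's inequality for real weights, with its equality case *)

Section RealKlein.
Variable R : realType.

(** For positive arguments this is the strict inequality [1 + t < expR t] at [t = ln (y / x)],
    multiplied by [x]. The implication from [y = 0] to [x = 0] is the scalar counterpart of the
    inclusion of supports. *)
Lemma ltr_mul_subln (x y : R) :
  0 <= x -> 0 <= y -> (y = 0 -> x = 0) -> x != y -> x - y < x * (ln x - ln y).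
Proof.
move=> x0 y0 yx xy; have [x_eq0|x_neq0] := eqVneq x 0.
  by move: xy; rewrite x_eq0 mul0r sub0r oppr_lt0 lt_neqAle y0 andbT.
have y_neq0 : y != 0 by apply: contra_neq x_neq0.
have {}x0 : 0 < x by rewrite lt_neqAle eq_sym x_neq0.
have {}y0 : 0 < y by rewrite lt_neqAle eq_sym y_neq0.
have yx0 : 0 < y / x by rewrite divr_gt0.
have : 1 + ln (y / x) < expR (ln (y / x)).
  apply: expR_gt1Dx; rewrite ln_eq0 // -(inj_eq (mulIf x_neq0)).
  by rewrite mul1r divfK // eq_sym.
rewrite lnK ?posrE // ln_div ?posrE // ltr_pdivlMr //.
by move=> ?; lra.
Qed.

(* Given doubly stochastic weights c, it is enough to sum the scalar inequality
   p - q <= p (ln p - ln q), whose left-hand sides add up to 0. *)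
Lemma klein_eq n (p q : 'I_n -> R) (c : 'I_n -> 'I_n -> R) :
    (forall i, 0 <= p i) -> (forall j, 0 <= q j) ->
    (forall i j, 0 <= c i j) ->
    (forall i, \sum_j c i j = 1) -> (forall j, \sum_i c i j = 1) ->
    \sum_i p i = \sum_j q j ->
    (forall i j, q j = 0 -> p i != 0 -> c i j = 0) ->
    \sum_i \sum_j c i j * (p i * (ln (p i) - ln (q j))) <= 0 ->
  forall i j, c i j != 0 -> p i = q j.
Proof.
move=> p0 q0 c0 c1 c1' pq supp le0.
(* [d i j] is the weighted gap in the scalar inequality. All gaps are nonnegative and their total is
   at most 0, so a single pair with [c i j != 0] and [p i != q j] gives a contradiction. *)
pose d i j := c i j * (p i * (ln (p i) - ln (q j)) - (p i - q j)).
have d_gt0 i j : c i j != 0 -> p i != q j -> 0 < d i j.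
  move=> cij pij; apply: mulr_gt0; first by rewrite lt0r cij c0.
  rewrite subr_gt0 ltr_mul_subln // => qj0.
  by apply/eqP; apply: contra_neqT cij; apply: supp.
have d_ge0 i j : 0 <= d i j.
  have [cij|cij] := eqVneq (c i j) 0; first by rewrite /d cij mul0r.
  have [pij|pij] := eqVneq (p i) (q j); last exact: ltW (d_gt0 _ _ cij pij).
  by rewrite /d pij !subrr mulr0 subrr mulr0.
have dsum : \sum_i \sum_j d i j <= 0.
  have -> : \sum_i \sum_j d i j =
      \sum_i \sum_j c i j * (p i * (ln (p i) - ln (q j))) -
      (\sum_i \sum_j c i j * p i - \sum_i \sum_j c i j * q j).
    rewrite -!sumrB; apply: eq_bigr => i _; rewrite -!sumrB.
    by apply: eq_bigr => j _; rewrite /d; ring.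
  have -> : \sum_i \sum_j c i j * p i = \sum_i p i.
    by apply: eq_bigr => i _; rewrite -mulr_suml c1 mul1r.
  have -> : \sum_i \sum_j c i j * q j = \sum_j q j.
    rewrite exchange_big; apply: eq_bigr => j _.
    by rewrite -mulr_suml c1' mul1r.
  by rewrite pq subrr subr0.
move=> i j cij; apply/eqP; apply: contraTT isT => pij.
have row_ge0 k : 0 <= \sum_l d k l by apply: sumr_ge0.
have : 0 < \sum_i \sum_j d i j.
  rewrite (bigD1 i) //= (bigD1 j) //= -addrA ltr_pwDl ?d_gt0 //.
  by rewrite addr_ge0 // sumr_ge0.
by rewrite ltNge dsum.
Qed.

End RealKlein.

(** * Spectral form of the relative entropy *)

Section Spectral.
Variable R : realType.
Local Notation C := R[i].

(** The quadratic form of [A] is real, so that of [A - A^t*] vanishes. Polarization then applies to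
    the functional sending [X] to the trace of [A - A^t*] times [X], whose value at [delta_mx j i]
    is the entry [i j] of the difference. *)
Lemma psdmx_hermitian n (A : 'M[C]_n) : psdmx A -> A = A^t*.
Proof.
move=> psdA; apply/eqP; rewrite -subr_eq0; apply/eqP/matrixP => i j.
pose D := (mxtrace \o mulmx (A - A^t*)) : {linear 'M[C]_n -> C^o}.
have D0 (v : 'rV[C]_n) : D (v^t* *m v) = 0.
  rewrite /= mulmxA mxtrace_mulC mulmxA mulmxBr mulmxBl linearB /=.
  have -> : v *m A^t* *m v^t* = (v *m A *m v^t*)^t*.
    by rewrite !trmxC_mul trmxCK mulmxA.
  rewrite !trace_mx11 !mxE; apply/eqP; rewrite subr_eq0 eq_sym.
  by have /ger0_real /CrealP := psdA v; rewrite !mxE => ->.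
have := linear_rank1_eq0 D0 (delta_mx j i); rewrite /=.
rewrite /mxtrace (bigD1 i) //= big1 ?addr0 => [|k /negbTE ki]; last first.
  by rewrite mxE big1 // => l _; rewrite !mxE ki andbF mulr0.
rewrite mxE (bigD1 j) //= big1 ?addr0 => [|l /negbTE lj]; last first.
  by rewrite !mxE lj mulr0.
by rewrite !mxE !eqxx mulr1.
Qed.

Definition eigval n (A : 'M[C]_n) (i : 'I_n) : R :=
  complex.Re (spectral_diag A 0 i).

(** Nonnegativity holds because each eigenvalue is the value of the quadratic form at the matching
    row of [spectralmx A]. In particular it is real, so [eigval] loses nothing by taking real
    parts. *)
Lemma psdmx_spectral n (A : 'M[C]_n) : psdmx A ->
  A = (spectralmx A)^t* *m diag_mx (\row_i (eigval A i)%:C%C) *m spectralmx A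
  /\ forall i, 0 <= eigval A i.
Proof.
move=> psdA; have Uu := spectral_unitarymx A.
have /hermitian_normalmx/orthomx_spectralP: A \is hermsymmx.
  by apply/is_hermitianmxP; rewrite expr0 scale1r; apply: psdmx_hermitian.
rewrite invmx_unitary // => AE.
have ge0 i : 0 <= spectral_diag A 0 i.
  have := psdA (row i (spectralmx A)).
  rewrite rowE trmxC_mul [X in _ *m X *m _]AE !mulmxA.
  rewrite mulmxtVK // mulmxtVK // -rowE trmx_delta map_delta_mx -colE.
  by rewrite !mxE eqxx mulr1n.
have diagE : spectral_diag A = \row_i (eigval A i)%:C%C.
  by apply/rowP => i; rewrite mxE RRe_real // ger0_real.
split=> [|i]; first by rewrite -diagE.
by have := ge0 i; rewrite lecE => /andP[].
Qed.

Lemma psdmx_trace n (A : 'M[C]_n) : psdmx A -> \tr A = (\sum_i eigval A i)%:C%C.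
Proof.
move=> /psdmx_spectral[AE _]; rewrite [in LHS]AE.
rewrite mxtrace_mulC mulmxA (unitarymxP (spectral_unitarymx _)) mul1mx.
by rewrite mxtrace_diag rmorph_sum; apply: eq_bigr => i _; rewrite mxE.
Qed.

Lemma logmxE n (A : 'M[C]_n) :
  logmx A = (spectralmx A)^t* *m
    diag_mx (\row_i (log2 (eigval A i))%:C%C) *m spectralmx A.
Proof.
rewrite /logmx; set d := map_mx _ (spectral_diag A).
suff -> : d = \row_i (log2 (eigval A i))%:C%C by [].
by apply/rowP => i; rewrite !mxE.
Qed.

Definition sqnormc (z : C) : R := complex.Re z ^+ 2 + complex.Im z ^+ 2.

Lemma sqnormcE z : (sqnormc z)%:C%C = z * z^*.
Proof. by rewrite add_Re2_Im2 normCK. Qed.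

Lemma sqnormc_ge0 z : 0 <= sqnormc z.
Proof. by rewrite addr_ge0 // sqr_ge0. Qed.

Lemma sqnormc_eq0 z : (sqnormc z == 0) = (z == 0).
Proof.
rewrite -(inj_eq (@complexI R)) sqnormcE.
by rewrite -normCK expf_eq0 normr_eq0.
Qed.

Lemma sum_sqnormc_row m n (M : 'M[C]_(m, n)) i :
  M \is unitarymx -> \sum_j sqnormc (M i j) = 1.
Proof.
move=> /unitarymxP/matrixP/(_ i i); rewrite !mxE eqxx => M1.
apply: (@complexI R); rewrite rmorph_sum /= -[RHS]M1.
by apply: eq_bigr => j _; rewrite sqnormcE !mxE.
Qed.

Lemma sum_sqnormc_col n (M : 'M[C]_n) j :
  M \is unitarymx -> \sum_i sqnormc (M i j) = 1.
Proof.
rewrite -trmx_unitary => /(sum_sqnormc_row j) <-.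
by apply: eq_bigr => i _; rewrite mxE.
Qed.

(** Cyclicity of the trace leaves the two diagonal matrices separated by [M = U *m V^t*] and its
    adjoint, so each entry of [M] meets its own conjugate. *)
Lemma mxtrace_mul_diag_conj n (U V : 'M[C]_n) (a b : 'I_n -> R) :
  \tr (U^t* *m diag_mx (\row_i (a i)%:C%C) *m U *m
      (V^t* *m diag_mx (\row_i (b i)%:C%C) *m V)) =
  (\sum_i \sum_j sqnormc ((U *m V^t*) i j) * (a i * b j))%:C%C.
Proof.
rewrite -!mulmxA mxtrace_mulC; set M := U *m V^t*.
have -> : \tr (diag_mx (\row_i (a i)%:C%C) *m
      (U *m (V^t* *m (diag_mx (\row_i (b i)%:C%C) *m V))) *m U^t*) =
    \tr (diag_mx (\row_i (a i)%:C%C) *m M *m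
      diag_mx (\row_i (b i)%:C%C) *m M^t*).
  by rewrite trmxC_mul trmxCK !mulmxA.
rewrite mul_diag_mx mul_mx_diag rmorph_sum; apply: eq_bigr => i _.
rewrite mxE rmorph_sum; apply: eq_bigr => j _; rewrite !mxE.
by rewrite !rmorphM /= sqnormcE; ring.
Qed.

(** The entry [i j] is the inner product of the eigenvectors [i] of [A] and [j] of [B]. Its squared
    moduli are the doubly stochastic weights of [klein_eq]. *)
Definition overlap n (A B : 'M[C]_n) : 'M[C]_n :=
  spectralmx A *m (spectralmx B)^t*.

Lemma overlap_unitary n (A B : 'M[C]_n) : overlap A B \is unitarymx.
Proof. by rewrite mul_unitarymx ?trmxC_unitary ?spectral_unitarymx. Qed.

Lemma mxtrace_entropy n (rho sigma : 'M[C]_n) : psdmx rho ->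
  \tr (rho *m (logmx rho - logmx sigma)) =
  (\sum_i \sum_j sqnormc (overlap rho sigma i j) *
    (eigval rho i * (log2 (eigval rho i) - log2 (eigval sigma j))))%:C%C.
Proof.
move=> /psdmx_spectral[rhoE _]; rewrite mulmxBr linearB /= !logmxE.
rewrite [X in \tr (X *m _) - _]rhoE [X in _ - \tr (X *m _)]rhoE.
rewrite !mxtrace_mul_diag_conj -rmorphB /=; congr (_%:C%C).
rewrite -sumrB; apply: eq_bigr => i _.
have -> : \sum_j sqnormc ((spectralmx rho *m (spectralmx rho)^t*) i j) *
    (eigval rho i * log2 (eigval rho j)) = eigval rho i * log2 (eigval rho i).
  rewrite (unitarymxP (spectral_unitarymx _)) (bigD1 i) //= big1 => [|j ji].
    by rewrite mxE eqxx /sqnormc /= expr1n expr0n /= !addr0 mul1r.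
  by rewrite mxE eq_sym (negbTE ji) /sqnormc /= expr0n /= addr0 mul0r.
(* The term in [rho] alone is spread over all [j], as the squared moduli in row [i] of the overlap
   add up to 1. *)
rewrite -[X in X - _]mul1r -(sum_sqnormc_row i (overlap_unitary rho sigma)).
by rewrite mulr_suml -sumrB; apply: eq_bigr => j _; rewrite -!mulrBr.
Qed.

(** An eigenvector of [sigma] with eigenvalue 0 lies in the kernel of [sigma]. Passing to orthogonal
    complements, the inclusion of supports puts it in the kernel of [rho], which is orthogonal to
    every eigenvector of [rho] with nonzero eigenvalue. *)
Lemma overlap_support n (rho sigma : 'M[C]_n) i j :
  psdmx rho -> psdmx sigma -> (mxsupport rho <= mxsupport sigma)%MS ->
  eigval sigma j = 0 -> eigval rho i != 0 -> overlap rho sigma i j = 0.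
Proof.
move=> /psdmx_spectral[rhoE _] /psdmx_spectral[sigmaE _].
rewrite submx_ortho => kersub q0 p_neq0.
have : (row j (spectralmx sigma) <= kermx rho)%MS.
  apply: submx_trans kersub; apply/sub_kermxP.
  rewrite [X in _ *m X]sigmaE rowE !mulmxA mulmxtVK ?spectral_unitarymx //.
  rewrite -rowE row_diag_mx !mxE q0 scale0r mul0mx //.
move=> /sub_kermxP; rewrite [X in _ *m X]rhoE.
move=> /(congr1 (mulmxr ((spectralmx rho)^t*))) /=.
rewrite mul0mx !mulmxA mulmxtVK ?spectral_unitarymx // => /matrixP/(_ 0 i).
rewrite mul_mx_diag -row_mul mxE [X in X * _]mxE [X in _ * X]mxE [RHS]mxE.
move=> /eqP; rewrite mulf_eq0 [X in _ || X](_ : _ = false) ?orbF; last first.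
  by apply/negbTE; rewrite -(inj_eq (@complexI R)) in p_neq0.
move=> /eqP VU0; have -> : overlap rho sigma = (overlap sigma rho)^t*.
  by rewrite /overlap trmxC_mul trmxCK.
by rewrite mxE mxE VU0 conjC0.
Qed.

(* The overlap matrix intertwines the two diagonal forms. *)
Lemma overlap_eq n (rho sigma : 'M[C]_n) : psdmx rho -> psdmx sigma ->
  (forall i j, overlap rho sigma i j != 0 -> eigval rho i = eigval sigma j) ->
  rho = sigma.
Proof.
move=> /psdmx_spectral[rhoE _] /psdmx_spectral[sigmaE _] eqv.
have : diag_mx (\row_i (eigval rho i)%:C%C) *m overlap rho sigma =
    overlap rho sigma *m diag_mx (\row_i (eigval sigma i)%:C%C).
  rewrite mul_diag_mx mul_mx_diag; apply/matrixP => i j; rewrite mxE [RHS]mxE.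
  rewrite [X in X * _]mxE [X in _ = _ * X]mxE.
  have [->|/eqv ->] := eqVneq (overlap rho sigma i j) 0; last exact: mulrC.
  by rewrite mul0r mulr0.
have : overlap rho sigma *m spectralmx sigma = spectralmx rho.
  by rewrite /overlap mulmxKtV // spectral_unitarymx.
have : (spectralmx rho)^t* *m overlap rho sigma = (spectralmx sigma)^t*.
  rewrite /overlap mulmxA -(invmx_unitary (spectral_unitarymx rho)).
  by rewrite mulVmx ?spectral_unit // mul1mx.
move: (overlap rho sigma) => M VE UE comm.
by rewrite rhoE sigmaE -VE -(mulmxA _ M) -comm -!mulmxA UE.
Qed.

(** The equality case of Klein's inequality for matrices. Only an upper bound is assumed, since that
    is what a vanishing supremum gives for each state. *)
Lemma relative_entropy_le0 n (rho sigma : 'M[C]_n) :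
  psdmx rho -> psdmx sigma -> \tr rho = \tr sigma ->
  (relative_entropy rho sigma <= 0)%E -> rho = sigma.
Proof.
(* Without inclusion of supports the entropy is [+oo], which contradicts the bound. *)
move=> psd_rho psd_sigma tr_eq; rewrite /relative_entropy; case: ifP => // supp.
rewrite mxtrace_entropy // lee_fin /= => le0; apply: overlap_eq => // i j.
rewrite -sqnormc_eq0; move: i j.
apply: (@klein_eq _ _ _ _ (fun i j => sqnormc (overlap rho sigma i j))).
- by have [] := psdmx_spectral psd_rho.
- by have [] := psdmx_spectral psd_sigma.
- by move=> i j; apply: sqnormc_ge0.
- by move=> i; apply/sum_sqnormc_row/overlap_unitary.
- by move=> j; apply/sum_sqnormc_col/overlap_unitary.
- by apply: (@complexI R); rewrite -!psdmx_trace.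
- by move=> i j q0 p_neq0; apply/eqP; rewrite sqnormc_eq0 overlap_support.
(* Passing from [log2] to [ln] multiplies the sum by the positive constant [ln 2], which preserves
   its sign. *)
have ln2_gt0 : 0 < ln (2 : R) by rewrite ln_gt0 // ltr1n.
rewrite -(pmulr_lle0 _ (_ : 0 < (ln 2)^-1)) ?invr_gt0 // mulr_suml.
apply: le_trans le0; rewrite le_eqVlt; apply/orP; left; apply/eqP.
apply: eq_bigr => i _; rewrite mulr_suml; apply: eq_bigr => j _.
by rewrite /log2; ring.
Qed.

Lemma relative_entropyxx n (rho : 'M[C]_n) : relative_entropy rho rho = 0%E.
Proof. by rewrite /relative_entropy submx_refl subrr mulmx0 mxtrace0. Qed.

End Spectral.

(** * Pinchings by projective measurements *)

Section Pinching.
Variable R : realType.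
Local Notation C := R[i].

Definition projective_measurement (I : finType) n (P : I -> 'M[C]_n) : Prop :=
  [/\ forall a, (P a)^t* = P a,
      forall a b, P a *m P b = if a == b then P a else 0 &
      \sum_a P a = 1%:M].

Lemma pinching_is_linear (I : finType) n (P : I -> 'M[C]_n) :
  linear (pinching P).
Proof.
move=> c X Y; rewrite /pinching scaler_sumr -big_split /=.
by apply: eq_bigr => a _; rewrite mulmxDr mulmxDl -scalemxAr -scalemxAl.
Qed.

HB.instance Definition _ (I : finType) n (P : I -> 'M[C]_n) :=
  GRing.isLinear.Build C 'M[C]_n 'M[C]_n *:%R (pinching P)
    (pinching_is_linear P).

Section Measurement.
Variables (I : finType) (n : nat) (P : I -> 'M[C]_n).
Hypothesis measP : projective_measurement P.

Lemma pinching_idem X : pinching P (pinching P X) = pinching P X.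
Proof.
case: measP => _ PP _; rewrite {1}/pinching; apply: eq_bigr => a _.
rewrite /pinching mulmx_sumr mulmx_suml (bigD1 a) //= big1 => [|b ba].
  by rewrite addr0 !mulmxA PP eqxx -mulmxA PP eqxx.
by rewrite !mulmxA PP eq_sym (negbTE ba) !mul0mx.
Qed.

Lemma mxtrace_pinching X : \tr (pinching P X) = \tr X.
Proof.
case: measP => _ PP P1; rewrite /pinching linear_sum /=.
rewrite -[in RHS](mulmx1 X) -P1 mulmx_sumr linear_sum; apply: eq_bigr => a _.
by rewrite mxtrace_mulC mulmxA PP eqxx mxtrace_mulC.
Qed.

Lemma psdmx_pinching X : psdmx X -> psdmx (pinching P X).
Proof.
case: measP => Pherm _ _ psdX v.
rewrite /pinching mulmx_sumr mulmx_suml summxE sumr_ge0 // => a _.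
by have := psdX (v *m P a); rewrite trmxC_mul Pherm !mulmxA.
Qed.

Lemma states_pinching X : states n X -> states n (pinching P X).
Proof.
by case=> psdX trX; split; [apply: psdmx_pinching | rewrite mxtrace_pinching].
Qed.

End Measurement.

Lemma dephasing_measurement n (U : 'M[C]_n) : U \is unitarymx ->
  projective_measurement (fun a => (row a U)^t* *m row a U).
Proof.
move=> Uu; split.
- by move=> a; rewrite trmxC_mul trmxCK.
- move=> a b; rewrite mulmxA -[_ *m _ *m (row b U)^t*]mulmxA.
  have -> : row a U *m (row b U)^t* = (a == b)%:R%:M.
    rewrite [LHS]mx11_scalar -dotmxE; congr _%:M.
    by have /row_unitarymxP := Uu; apply.
  case: eqP => [<-|_]; first by rewrite mulmx1.
  by rewrite rmorph0 mulmx0 mul0mx.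
- rewrite -(mulVmx (unitarymx_unit Uu)) invmx_unitary //.
  apply/matrixP => i j; rewrite summxE mxE; apply: eq_bigr => a _.
  by rewrite !mxE big_ord1 !mxE.
Qed.

(** The measurement with one outcome, which represents a tensor factor that is not dephased. *)
Lemma id_measurement n :
  projective_measurement (fun _ : unit => 1%:M : 'M[C]_n).
Proof.
split=> [a|[] []|]; first by rewrite trmx1 map_mx1.
- by rewrite mulmx1.
- by rewrite big_const card_unit /= addr0.
Qed.

Lemma pinching_id n : id =1 pinching (fun _ : unit => 1%:M : 'M[C]_n).
Proof.
by move=> X; rewrite /pinching big_const card_unit /= addr0 mul1mx mulmx1.
Qed.

(** * Tensor products of measurements and of their pinchings *)

Definition tens_family (I J : Type) m n (P : I -> 'M[C]_m)
    (Q : J -> 'M[C]_n)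
    (ab : I * J) : 'M[C]_(m * n) := P ab.1 *t Q ab.2.

Lemma tensmx_suml m n p q (I : finType) (F : I -> 'M[C]_(m, n))
    (B : 'M[C]_(p, q)) :
  (\sum_i F i) *t B = \sum_i F i *t B.
Proof.
by apply/matrixP => i j; rewrite summxE mxE summxE mulr_suml;
  apply: eq_bigr => k _; rewrite mxE.
Qed.

Lemma tensmx_sumr m n p q (I : finType) (A : 'M[C]_(m, n))
    (F : I -> 'M[C]_(p, q)) :
  A *t (\sum_i F i) = \sum_i A *t F i.
Proof.
by apply/matrixP => i j; rewrite summxE mxE summxE mulr_sumr;
  apply: eq_bigr => k _; rewrite mxE.
Qed.

Lemma tensmx1 m n : (1%:M : 'M[C]_m) *t (1%:M : 'M[C]_n) = 1%:M.
Proof.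
apply/matrixP => i j; case: (mxtens_indexP i) => i1 i2.
case: (mxtens_indexP j) => j1 j2; rewrite tensmxE !mxE.
by rewrite (can_eq (@mxtens_indexK m n)) xpair_eqE -natrM mulnb.
Qed.

Lemma tens_measurement (I J : finType) m n (P : I -> 'M[C]_m)
    (Q : J -> 'M[C]_n) :
  projective_measurement P -> projective_measurement Q ->
  projective_measurement (tens_family P Q).
Proof.
move=> [Ph PP P1] [Qh QQ Q1]; split.
- by case=> a b; rewrite /tens_family trmx_tens map_mxT /= Ph Qh.
- case=> a b [a' b']; rewrite /tens_family tensmx_mul /= PP QQ xpair_eqE.
  by case: (a == a'); case: (b == b'); rewrite /= ?tensmx0 ?tens0mx.
- rewrite -tensmx1 -P1 -Q1 tensmx_suml.
  rewrite -(pair_bigA _ (fun a b => P a *t Q b)) /=.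
  by apply: eq_bigr => a _; rewrite tensmx_sumr.
Qed.

Lemma pinching_tens (I J : finType) m n (P : I -> 'M[C]_m)
    (Q : J -> 'M[C]_n) A B :
  pinching (tens_family P Q) (A *t B) = pinching P A *t pinching Q B.
Proof.
rewrite /pinching tensmx_suml -(pair_bigA _
  (fun a b => tens_family P Q (a, b) *m (A *t B) *m tens_family P Q (a, b))) /=.
apply: eq_bigr => a _; rewrite tensmx_sumr; apply: eq_bigr => b _.
by rewrite /tens_family !tensmx_mul.
Qed.

(** Products of matrix units span the matrices on the tensor product, so a linear map is determined
    by its values on them. *)
Lemma tensmap_unique m n (F : 'M[C]_m -> 'M[C]_m) (G : 'M[C]_n -> 'M[C]_n)
    (H : {linear 'M[C]_(m * n) -> 'M[C]_(m * n)}) :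
  (forall A B, H (A *t B) = F A *t G B) -> tensmap F G =1 H.
Proof.
move=> HE X.
have XE : X = \sum_(i < m) \sum_(j < m) \sum_(k < n) \sum_(l < n)
    X (mxtens_index (i, k)) (mxtens_index (j, l)) *:
      (delta_mx i j *t delta_mx k l).
  apply/matrixP => a b; case: (mxtens_indexP a) => a1 a2.
  case: (mxtens_indexP b) => b1 b2.
  rewrite summxE (bigD1 a1) //= [X in _ + X]big1 => [|i /negbTE ia]; last first.
    rewrite summxE big1 // => j _; rewrite summxE big1 // => k _.
    rewrite summxE big1 // => l _.
    by rewrite mxE tensmxE !mxE [a1 == i]eq_sym ia /= mul0r mulr0.
  rewrite addr0 summxE (bigD1 b1) //= [X in _ + X]big1 =>
    [|j /negbTE jb]; last first.
    rewrite summxE big1 // => k _; rewrite summxE big1 // => l _.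
    by rewrite mxE tensmxE !mxE [b1 == j]eq_sym jb andbF mul0r mulr0.
  rewrite addr0 summxE (bigD1 a2) //= [X in _ + X]big1 =>
    [|k /negbTE ka]; last first.
    rewrite summxE big1 // => l _.
    by rewrite mxE tensmxE !mxE [a2 == k]eq_sym ka /= !mulr0.
  rewrite addr0 summxE (bigD1 b2) //= [X in _ + X]big1 =>
    [|l /negbTE lb]; last first.
    by rewrite mxE tensmxE !mxE [b2 == l]eq_sym lb andbF !mulr0.
  by rewrite addr0 mxE tensmxE !mxE !eqxx !mulr1.
rewrite {2}XE linear_sum; apply: eq_bigr => i _; rewrite linear_sum.
apply: eq_bigr => j _; rewrite linear_sum; apply: eq_bigr => k _.
by rewrite linear_sum; apply: eq_bigr => l _; rewrite linearZ /= HE.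
Qed.

Lemma tensmap_pinching (I J : finType) m n F G (P : I -> 'M[C]_m)
    (Q : J -> 'M[C]_n) :
  F =1 pinching P -> G =1 pinching Q ->
  tensmap F G =1 pinching (tens_family P Q).
Proof.
by move=> FE GE; apply: tensmap_unique => A B; rewrite /= pinching_tens FE GE.
Qed.

(** This reduces the four kinds of einselection to one, making linearity, idempotence and
    preservation of states available for all of them. *)
Lemma einselection_pinching n (Gamma : 'M[C]_n -> 'M[C]_n) :
  einselection Gamma -> exists (I : finType) (P : I -> 'M[C]_n),
    projective_measurement P /\ Gamma =1 pinching P.
Proof.
case=> {n Gamma} [n U Uu|m n U V Uu Vu|m n U Uu|m n V Vu].
- by exists 'I_n, (fun a => (row a U)^t* *m row a U); split;
    first exact: dephasing_measurement.
- exists ('I_m * 'I_n)%type, (tens_family (fun a => (row a U)^t* *m row a U)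
    (fun b => (row b V)^t* *m row b V)).
  by split; [apply: tens_measurement; apply: dephasing_measurement
            | apply: tensmap_pinching].
- exists ('I_m * unit)%type, (tens_family (fun a => (row a U)^t* *m row a U)
    (fun _ => 1%:M)).
  split; last by apply: tensmap_pinching => //; apply: pinching_id.
  by apply: tens_measurement; [exact: dephasing_measurement | exact: id_measurement].
- exists (unit * 'I_n)%type, (tens_family (fun _ => 1%:M)
    (fun b => (row b V)^t* *m row b V)).
  split; last by apply: tensmap_pinching => //; apply: pinching_id.
  by apply: tens_measurement; [exact: id_measurement | exact: dephasing_measurement].
Qed.

End Pinching.

(** * Action of operations on states, and the equivalences *)

Section Operations.
Variable R : realType.
Local Notation C := R[i].

Lemma psdmx_castmx m n (e : m = n) (A : 'M[C]_m) :
  psdmx (castmx (e, e) A) <-> psdmx A.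
Proof. by case: n / e; rewrite castmx_id. Qed.

Lemma psdmx_tens11 n (A : 'M[C]_n) :
  psdmx (A *t (1%:M : 'M[C]_1)) <-> psdmx A.
Proof. by rewrite tens_mx_scalar scale1r psdmx_castmx. Qed.

(** Complete positivity with a one-dimensional ancilla is positivity, up to the identification of
    [n * 1] with [n]. *)
Lemma completely_positive_psdmx n (Lambda : {linear 'M[C]_n -> 'M[C]_n}) A :
  completely_positive Lambda -> psdmx A -> psdmx (Lambda A).
Proof.
move=> cpL /psdmx_tens11/(cpL 1%N).
by rewrite (tensmapE Lambda idfun) => /psdmx_tens11.
Qed.

Lemma quantum_operation_states n (Lambda : {linear 'M[C]_n -> 'M[C]_n}) rho :
  quantum_operation Lambda -> states n rho -> states n (Lambda rho).
Proof.
move=> [cpL tpL] [psd_rho tr_rho].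
by split; [apply: completely_positive_psdmx | rewrite tpL].
Qed.

Lemma psdmx_rank1 n (v : 'rV[C]_n) : psdmx (v^t* *m v).
Proof.
move=> w; rewrite mulmxA -mulmxA.
have -> : v *m w^t* = (w *m v^t*)^t* by rewrite trmxC_mul trmxCK.
by rewrite mxE big_ord1 !mxE mul_conjC_ge0.
Qed.

Lemma mxtrace_rank1 n (v : 'rV[C]_n) : \tr (v^t* *m v) = (v *m v^t*) 0 0.
Proof. by rewrite mxtrace_mulC trace_mx11. Qed.

(** A nonzero rank-one matrix [v^t* *m v] is a positive multiple of a pure state, its trace being
    the squared norm of [v]. Hence [F - G] vanishes on all of these, and polarization concludes. *)
Lemma linear_states_eq n (V : lmodType C) (F G : {linear 'M[C]_n -> V}) :
  (forall rho, states n rho -> F rho = G rho) -> F =1 G.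
Proof.
move=> FG; suff FG0 : F \- G =1 fun=> 0.
  by move=> X; apply/eqP; rewrite -subr_eq0; apply/eqP/FG0.
apply: linear_rank1_eq0 => v; have [->|v0] := eqVneq v 0.
  by rewrite mulmx0 linear0.
have t0 : 0 < (v *m v^t*) 0 0 by rewrite -dotmxE; apply: dotmx_is_dotmx.
set t := (v *m v^t*) 0 0 in t0; have t_neq0 : t != 0 by rewrite gt_eqF.
have /FG : states n (t^-1 *: (v^t* *m v)).
  split=> [w|]; last by rewrite linearZ /= mxtrace_rank1 mulVf.
  rewrite -scalemxAr -scalemxAl mxE mulr_ge0 ?psdmx_rank1 //.
  by rewrite invr_ge0 ltW.
rewrite !linearZ => /(scalerI (invr_neq0 t_neq0)) /= ->.
by rewrite subrr.
Qed.

Lemma states_nonempty n : (0 < n)%N -> exists rho : 'M[C]_n, states n rho.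
Proof.
case: n => // n _; exists ((delta_mx 0 0 : 'rV[C]_n.+1)^t* *m delta_mx 0 0).
split; first exact: psdmx_rank1.
by rewrite mxtrace_rank1 trmx_delta map_delta_mx mul_delta_mx mxE !eqxx.
Qed.

End Operations.

(* States exist only in positive dimension, whence the hypothesis on n. *)
Theorem mainTheorem6 (R : realType) (n : nat) (n_gt0 : (0 < n)%N)
    (Lambda : {linear 'M[R[i]]_n -> 'M[R[i]]_n})
    (Gamma : 'M[R[i]]_n -> 'M[R[i]]_n) :
  quantum_operation Lambda -> einselection Gamma ->
  (Lambda \o Gamma =1 Gamma \o Lambda <-> W Lambda Gamma = 0%E) /\
  (Lambda \o Gamma =1 Gamma \o Lambda <->
    forall rho : 'M[R[i]]_n, states n rho ->
      distinguishing_power Lambda Gamma rho = 0%E /\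
      generating_power Lambda Gamma rho = 0%E).
Proof.
move=> qL /einselection_pinching[I [P [measP GE]]].
have GammaS rho : states n rho -> states n (Gamma rho).
  by rewrite GE; apply: states_pinching.
have LambdaS rho : states n rho -> states n (Lambda rho).
  exact: quantum_operation_states.
have eq_states rho sigma : states n rho -> states n sigma ->
    (relative_entropy rho sigma <= 0)%E -> rho = sigma.
  move=> [psd_rho tr_rho] [psd_sigma tr_sigma].
  by apply: relative_entropy_le0 => //; rewrite tr_rho.
have commute_states : (forall rho, states n rho ->
    Lambda (Gamma rho) = Gamma (Lambda rho)) ->
    Lambda \o Gamma =1 Gamma \o Lambda.
  move=> comm X; rewrite /= !GE.
  apply: (linear_states_eq (F := Lambda \o pinching P)
    (G := pinching P \o Lambda)).
  by move=> rho /comm; rewrite !GE.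
split; split.
- move=> comm; have [rho0 rho0S] := states_nonempty R n_gt0.
  (* All entropies are 0, and a state is needed for the set of values to be a singleton: the
     supremum of the empty set is [-oo]. *)
  rewrite /W (_ : [set _ | _ in _]%classic = [set 0%E]%classic) ?ereal_sup1 //.
  apply/seteqP; split=> [_ [rho _ <-]|_ ->] /=.
    by rewrite -[Gamma (Lambda rho)]comm relative_entropyxx.
  by exists rho0; rewrite // -[Gamma (Lambda _)]comm relative_entropyxx.
- move=> W0; apply: commute_states => rho rhoS; apply: eq_states; auto.
  by rewrite -W0; apply: ereal_sup_ubound; exists rho.
- move=> comm rho rhoS; rewrite /distinguishing_power /generating_power.
  (* Commutation turns the left side into [Gamma] applied twice to [Lambda rho], and idempotence
     removes one application. Both powers then compare a matrix with itself. *)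
  have GLG : Gamma (Lambda (Gamma rho)) = Gamma (Lambda rho).
    by rewrite [Lambda (Gamma rho)]comm /= !GE pinching_idem.
  by rewrite GLG -[Gamma (Lambda rho)]comm !relative_entropyxx.
- move=> powers; apply: commute_states => rho rhoS.
  have [dist0 gen0] := powers rho rhoS.
  (* The generating power identifies [Lambda (Gamma rho)] with this intermediate state, and the
     distinguishing power identifies the latter with [Gamma (Lambda rho)]. *)
  transitivity (Gamma (Lambda (Gamma rho))); apply: eq_states; auto.
    by rewrite -/(generating_power Lambda Gamma rho) gen0.
  by rewrite -/(distinguishing_power Lambda Gamma rho) dist0.
Qed.
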